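(* Let $\mathbb{K}$ be a field and let $B=B^0\oplus B^1\oplus\cdots$ be a graded-commutative $\mathbb{K}$-algebra with multiplicative unit $e\in B^0$ and $\dim_{\mathbb{K}}(B^0)=1$. Let $A$ be an $n$-self-dual factor-algebra of $B$ with a chosen isomorphism $\phi\colon A^n\to\mathbb{K}$, and let $\rho\colon B\to A$ be the natural homomorphism. Then \[ A\simeq B/I(L_\ell), \] where $\ell$ is the $n$-homogeneous linear function defined by $\ell\colon B^n\to\mathbb{K}$, $\ell(b)=\phi(\rho(b))$, and extended by $0$ to $B^i$ with $i\neq n$. Moreover, for any $n$-homogeneous linear function $\ell$ on $B$, the algebra $A=B/I(L_\ell)$ is $n$-self-dual and the corresponding Frobenius form $F_{\ell_*}$ on $A$ is non-degenerate.
   Context: A graded $\mathbb{K}$-algebra is graded-commutative if $xy=(-1)^{\deg(x)\deg(y)}yx$ for homogeneous $x,y$. For a natural number $n$, a graded-commutative algebra $A$ is $n$-self-dual if: (1) it has a unit, which is homogeneous of degree $0$; (2) $A^k=0$ for $k>n$ and $\dim_{\mathbb{K}}A^n=1$; (3) the multiplication pairing $A^k\times A^{n-k}\to A^n$ is non-degenerate for $0\le k\le n$. An $n$-self-dual factor-algebra of $B$ is a quotient $B/I$ by a two-sided homogeneous ideal $I$ that is $n$-self-dual. A linear function $\ell\colon B\to\mathbb{K}$ is $n$-homogeneous if it is not identically zero and vanishes on $B^m$ for all $m\neq n$; $L_\ell=\{\ell=0\}\cap B^n$. The set $I(L_\ell)=\{a\in B:\ell(ab)=0\text{ for all }b\in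 B\}=\{b\in B:\ell(ab)=0\text{ for all }a\in B\}$ is a two-sided homogeneous ideal of $B$, depending only on $L_\ell$. There is a unique $n$-homogeneous linear function $\ell_*$ on $B/I(L_\ell)$ whose pull-back to $B$ is $\ell$, and $F_{\ell_*}(a,b)=\ell_*(ab)$. *)

(* Defs.v *)
From HB Require Import structures.
From mathcomp Require Import all_boot all_order all_algebra.
From mathcomp Require Import generic_quotient ring_quotient.
From mathcomp Require Import boolp.

Set Implicit Arguments.
Unset Strict Implicit.
Unset Printing Implicit Defensive.

Import GRing.Theory.
Local Open Scope ring_scope.
Local Open Scope quotient_scope.

Definition hdecomp (V : zmodType) (S : nat -> pred V) (x : V) (f : nat -> V) :=
  (forall i, f i \in S i) /\
  exists N, (forall i, (N <= i)%N -> f i = 0) /\ x = \sum_(i < N) f i.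

(* Unital, associative, graded-commutative K-algebras A = A^0 + A^1 + ...;     *)
(* homog A k is the homogeneous part A^k.  That the unit has degree 0 is not   *)
(* part of the structure.  As algType excludes the zero ring, so does this.    *)
Record gcAlg (K : fieldType) := GCAlg {
  gca_alg :> algType K;
  homog : nat -> pred gca_alg;
  homog_submod : forall k, submod_closed (homog k);
  homog_direct : forall x, exists! f, hdecomp homog x f;
  homogM : forall i j x y, x \in homog i -> y \in homog j ->
    x * y \in homog (i + j);
  homogC : forall i j x y, x \in homog i -> y \in homog j ->
    x * y = (-1) ^+ (i * j) * (y * x)
}.
Arguments homog {K} A k : rename.

HB.instance Definition _ (K : fieldType) (A : gcAlg K) k :=
  GRing.isSubmodClosed.Build K A (homog A k) (homog_submod A k).

Definition hpart (K : fieldType) (A : gcAlg K) (k : nat) : Type :=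
  {x : A | x \in homog A k}.

Section Hpart.
Variables (K : fieldType) (A : gcAlg K) (k : nat).
HB.instance Definition _ := SubChoice.on (hpart A k).
HB.instance Definition _ := [SubChoice_isSubLmodule of hpart A k by <:].
End Hpart.

Section Components.
Variables (K : fieldType) (A : gcAlg K).
Implicit Types (x y : A) (k : nat).

Definition hcomps x : nat -> A := projT1 (cid (homog_direct x)).

Lemma hcompsP x : hdecomp (homog A) x (hcomps x).
Proof. by rewrite /hcomps; case: cid => f []. Qed.

Lemma hcomps_uniq x f : hdecomp (homog A) x f -> hcomps x = f.
Proof. by rewrite /hcomps; case: cid => g [_ +] /=; apply. Qed.

Lemma hcomps_in x k : hcomps x k \in homog A k.
Proof. by case: (hcompsP x). Qed.

Definition hproj k x : hpart A k := Sub (hcomps x k) (hcomps_in x k).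

Lemma hcomps_linear k : linear (hcomps^~ k).
Proof.
move=> a x y; have [fx [N [fxN xE]]] := hcompsP x.
have [fy [M [fyM yE]]] := hcompsP y.
have widen (f : nat -> A) n m : (n <= m)%N -> (forall i, (n <= i)%N -> f i = 0) ->
    \sum_(i < n) f i = \sum_(i < m) f i.
  move=> nm f0; rewrite -!(big_mkord xpredT f) (big_cat_nat (n := n) (p := m)) //=.
  rewrite [X in _ = _ + X]big1_seq ?addr0 // => i.
  by rewrite mem_index_iota => /andP[_ /andP[/f0]].
rewrite (@hcomps_uniq _ (fun i => a *: hcomps x i + hcomps y i)) //.
split=> [i|]; first by rewrite rpredD ?rpredZ ?hcomps_in.
exists (maxn N M); split=> [i|].
  by rewrite geq_max => /andP[/fxN-> /fyM->]; rewrite scaler0 addr0.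
rewrite big_split -scaler_sumr /=; congr (_ *: _ + _).
  by rewrite {1}xE (widen _ _ _ (leq_maxl N M)).
by rewrite {1}yE (widen _ _ _ (leq_maxr N M)).
Qed.

Lemma hproj_linear k : linear (hproj k).
Proof. by move=> a x y; apply: val_inj; rewrite /= hcomps_linear. Qed.

HB.instance Definition _ k :=
  GRing.isLinear.Build K A (hpart A k) *:%R (hproj k) (hproj_linear k).

Lemma hcompsB x y k : hcomps (x - y) k = hcomps x k - hcomps y k.
Proof. exact: (congr1 \val (raddfB (hproj k) x y)). Qed.

Lemma hcomps_bigsum n (f : 'I_n -> A) k :
  hcomps (\sum_i f i) k = \sum_i hcomps (f i) k.
Proof.
rewrite -[LHS]/(\val (hproj k (\sum_i f i))) !raddf_sum.
by apply: eq_bigr.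
Qed.

Lemma hcomps_homog k x : x \in homog A k ->
  hcomps x = fun i => if i == k then x else 0.
Proof.
move=> xk; apply: hcomps_uniq; split=> [i|].
  by case: eqP => [->|_] //; rewrite rpred0.
exists k.+1; split=> [i ki|]; first by rewrite gtn_eqF.
rewrite big_ord_recr /= eqxx big1 ?add0r // => i _.
by rewrite ltn_eqF.
Qed.

Lemma hcomps_id k x : x \in homog A k -> hcomps x k = x.
Proof. by move/hcomps_homog->; rewrite eqxx. Qed.

Lemma hcomps_neq k i x : x \in homog A k -> i != k -> hcomps x i = 0.
Proof. by move/hcomps_homog-> => /negbTE->. Qed.

Lemma hcomps_sum x : exists N, forall M, (N <= M)%N -> x = \sum_(i < M) hcomps x i.
Proof.
have [_ [N [f0 xE]]] := hcompsP x; exists N => M NM.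
rewrite {1}xE -!(big_mkord xpredT (hcomps x)) (big_cat_nat (n := N) (p := M)) //=.
rewrite [X in _ = _ + X]big1_seq ?addr0 // => i.
by rewrite mem_index_iota => /andP[_ /andP[/f0]].
Qed.

End Components.

Definition has_dim (K : fieldType) (V : lmodType K) (d : nat) :=
  exists e : 'I_d -> V, forall v, exists! c : 'rV[K]_d, v = \sum_i c 0 i *: e i.

Definition self_dual (K : fieldType) (n : nat) (A : gcAlg K) :=
  [/\ 1 \in homog A 0,
      forall k, (n < k)%N -> forall x : hpart A k, x = 0,
      has_dim (hpart A n) 1
    & forall k, (k <= n)%N ->
      (forall a : hpart A k,
         (forall b : hpart A (n - k), \val a * \val b = 0) -> a = 0) /\
      (forall b : hpart A (n - k),
         (forall a : hpart A k, \val a * \val b = 0) -> b = 0)].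

Definition graded_iso (K : fieldType) (A A' : gcAlg K) :=
  exists f : {lrmorphism A -> A'}, bijective f /\
    forall k x, (f x \in homog A' k) = (x \in homog A k).

(* Two-sided homogeneous ideals.  They are proper, as MathComp's idealr is:    *)
(* for I = B the quotient is the zero ring, which is never n-self-dual because *)
(* its part of degree n has dimension 0.                                       *)
Record hideal (K : fieldType) (B : gcAlg K) := HIdeal {
  hid_pred :> pred B;
  hid_zmod : zmod_closed hid_pred;
  hid_proper : 1 \notin hid_pred;
  hid_Ml : forall a u, u \in hid_pred -> a * u \in hid_pred;
  hid_Mr : forall a u, u \in hid_pred -> u * a \in hid_pred;
  hid_homog : forall u, u \in hid_pred -> forall k, hcomps u k \in hid_pred
}.

HB.instance Definition _ (K : fieldType) (B : gcAlg K) (I : hideal B) :=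
  GRing.isZmodClosed.Build B (hid_pred I) (hid_zmod I).

Section FactorAlgebra.
Variables (K : fieldType) (B : gcAlg K) (I : hideal B).

Definition hquot : Type :=
  Quotient.quot (GRing.ZmodClosed.clone B (hid_pred I) _).

HB.instance Definition _ := GRing.Zmodule.on hquot.

HB.instance Definition _ := Quotient.on hquot.

Definition hpi (b : B) : hquot := \pi_hquot b.
Definition hrepr (x : hquot) : B := repr x.

Lemma hreprK x : hpi (hrepr x) = x. Proof. exact: reprK. Qed.

Lemma hpi_eq x y : (hpi x = hpi y) <-> (x - y \in hid_pred I).
Proof. by rewrite Quotient.idealrBE; split=> /eqP. Qed.

Lemma hpi_zmod : zmod_morphism hpi.
Proof. by move=> x y; rewrite /hpi raddfB. Qed.

HB.instance Definition _ := GRing.isZmodMorphism.Build B hquot hpi hpi_zmod.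

Definition hquot_one : hquot := hpi 1.
Definition hquot_mul (x y : hquot) : hquot := hpi (hrepr x * hrepr y).
Definition hquot_scale (a : K) (x : hquot) : hquot := hpi (a *: hrepr x).

Lemma hpi_mul x y : hquot_mul (hpi x) (hpi y) = hpi (x * y).
Proof.
rewrite /hquot_mul; apply/hpi_eq.
rewrite -[X in X - _](subrK (hrepr (hpi x) * y)) -mulrBr -addrA -mulrBl.
by apply: rpredD; [apply: hid_Ml|apply: hid_Mr]; apply/hpi_eq; rewrite hreprK.
Qed.

Lemma hpi_scale a x : hquot_scale a (hpi x) = hpi (a *: x).
Proof.
rewrite /hquot_scale; apply/hpi_eq; rewrite -scalerBr -mulr_algl.
by apply: hid_Ml; apply/hpi_eq; rewrite hreprK.
Qed.

Lemma hquot_ind (P : hquot -> Prop) : (forall b, P (hpi b)) -> forall x, P x.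
Proof. by move=> Pp x; rewrite -(hreprK x). Qed.

Lemma hquot_mulA : associative hquot_mul.
Proof.
by elim/hquot_ind=> x; elim/hquot_ind=> y; elim/hquot_ind=> z; rewrite !hpi_mul mulrA.
Qed.
Lemma hquot_mul1x : left_id hquot_one hquot_mul.
Proof. by elim/hquot_ind=> x; rewrite hpi_mul mul1r. Qed.
Lemma hquot_mulx1 : right_id hquot_one hquot_mul.
Proof. by elim/hquot_ind=> x; rewrite hpi_mul mulr1. Qed.
Lemma hquot_mulDl : left_distributive hquot_mul +%R.
Proof.
elim/hquot_ind=> x; elim/hquot_ind=> y; elim/hquot_ind=> z.
by rewrite -raddfD !hpi_mul mulrDl raddfD.
Qed.
Lemma hquot_mulDr : right_distributive hquot_mul +%R.
Proof.
elim/hquot_ind=> x; elim/hquot_ind=> y; elim/hquot_ind=> z.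
by rewrite -raddfD !hpi_mul mulrDr raddfD.
Qed.
Lemma hquot_one_neq0 : hquot_one != 0.
Proof.
apply/eqP; rewrite /hquot_one -(raddf0 hpi) => /hpi_eq.
by rewrite subr0 (negbTE (hid_proper I)).
Qed.

HB.instance Definition _ := GRing.Zmodule_isNzRing.Build hquot
  hquot_mulA hquot_mul1x hquot_mulx1 hquot_mulDl hquot_mulDr hquot_one_neq0.

Lemma hquot_scaleA a b v :
  hquot_scale a (hquot_scale b v) = hquot_scale (a * b) v.
Proof. by elim/hquot_ind: v => v; rewrite !hpi_scale scalerA. Qed.
Lemma hquot_scale1 : left_id 1 hquot_scale.
Proof. by elim/hquot_ind=> v; rewrite hpi_scale scale1r. Qed.
Lemma hquot_scaleDr : right_distributive hquot_scale +%R.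
Proof.
move=> a; elim/hquot_ind=> x; elim/hquot_ind=> y.
by rewrite -raddfD !hpi_scale scalerDr raddfD.
Qed.
Lemma hquot_scaleDl v : {morph hquot_scale^~ v : a b / a + b}.
Proof. by move=> a b; elim/hquot_ind: v => v; rewrite !hpi_scale scalerDl raddfD. Qed.

HB.instance Definition _ := GRing.Zmodule_isLmodule.Build K hquot
  hquot_scaleA hquot_scale1 hquot_scaleDr hquot_scaleDl.

Lemma hquot_scaleAl (a : K) (u v : hquot) : a *: (u * v) = (a *: u) * v.
Proof.
elim/hquot_ind: u => u; elim/hquot_ind: v => v.
by rewrite /GRing.scale /= /GRing.mul /= hpi_scale !hpi_mul hpi_scale scalerAl.
Qed.
HB.instance Definition _ := GRing.Lmodule_isLalgebra.Build K hquot hquot_scaleAl.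

Lemma hquot_scaleAr (a : K) (u v : hquot) : a *: (u * v) = u * (a *: v).
Proof.
elim/hquot_ind: u => u; elim/hquot_ind: v => v.
by rewrite /GRing.scale /= /GRing.mul /= hpi_scale !hpi_mul hpi_scale scalerAr.
Qed.
HB.instance Definition _ := GRing.Lalgebra_isAlgebra.Build K hquot hquot_scaleAr.

Lemma hpiM : monoid_morphism hpi.
Proof. by split=> [|x y]; rewrite // -hpi_mul. Qed.
HB.instance Definition _ := GRing.isMonoidMorphism.Build B hquot hpi hpiM.

Lemma hpiZ : scalable hpi.
Proof. by move=> a x; rewrite -hpi_scale. Qed.
HB.instance Definition _ := GRing.isScalable.Build K B hquot *:%R hpi hpiZ.

Definition hquot_homog (k : nat) : pred hquot :=
  fun x => `[< exists2 b, b \in homog B k & hpi b = x >].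

Lemma hquot_homogP k x :
  reflect (exists2 b, b \in homog B k & hpi b = x) (x \in hquot_homog k).
Proof. exact: asboolP. Qed.

Lemma hpi_homog k b : b \in homog B k -> hpi b \in hquot_homog k.
Proof. by move=> bk; apply/hquot_homogP; exists b. Qed.

Lemma hquot_submod k : submod_closed (hquot_homog k).
Proof.
split=> [|a u v].
  by rewrite -(raddf0 hpi) hpi_homog ?rpred0.
move=> /hquot_homogP[x xk <-] /hquot_homogP[y yk <-].
by rewrite -linearP hpi_homog // rpredD ?rpredZ.
Qed.

Lemma hquot_direct x : exists! f, hdecomp hquot_homog x f.
Proof.
elim/hquot_ind: x => x; exists (fun i => hpi (hcomps x i)); split.
  have [_ [N [f0 xE]]] := hcompsP x; split=> [i|].
    by rewrite hpi_homog ?hcomps_in.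
  exists N; split=> [i /f0->|]; first by rewrite raddf0.
  by rewrite {1}xE raddf_sum.
move=> g [gh [N [g0 xE]]].
have [h hP] : exists h : nat -> B, forall i, h i \in homog B i /\ hpi (h i) = g i.
  have hex i : exists b, b \in homog B i /\ hpi b = g i.
    by have /hquot_homogP[b] := gh i; exists b.
  by exists (fun i => projT1 (cid (hex i))) => i; case: cid.
pose h' i := if (i < N)%N then h i else 0.
have h'E i : hpi (h' i) = g i.
  rewrite /h'; case: ltnP => [_|/g0->]; first by case: (hP i).
  by rewrite raddf0.
pose y := \sum_(i < N) h' i.
have yE : hcomps y = h'.
  apply: hcomps_uniq; split=> [i|].
    by rewrite /h'; case: ifP => _; [case: (hP i) | rewrite rpred0].
  by exists N; split=> // i; rewrite /h' ltnNge => ->.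
have xyI : x - y \in hid_pred I.
  by apply/hpi_eq; rewrite xE raddf_sum; apply: eq_bigr => i _.
apply: functional_extensionality_dep => i; rewrite -h'E; apply/hpi_eq.
by rewrite -yE -hcompsB hid_homog.
Qed.

Lemma hquot_homogM i j x y : x \in hquot_homog i -> y \in hquot_homog j ->
  x * y \in hquot_homog (i + j).
Proof.
move=> /hquot_homogP[b bi <-] /hquot_homogP[c cj <-].
by rewrite -rmorphM hpi_homog ?homogM.
Qed.

Lemma hquot_homogC i j x y : x \in hquot_homog i -> y \in hquot_homog j ->
  x * y = (-1) ^+ (i * j) * (y * x).
Proof.
move=> /hquot_homogP[b bi <-] /hquot_homogP[c cj <-].
by rewrite -rmorphM (homogC bi cj) !rmorphM rmorphXn rmorphN1.
Qed.

Definition factor : gcAlg K :=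
  @GCAlg K hquot hquot_homog hquot_submod hquot_direct hquot_homogM hquot_homogC.

(* The natural homomorphism B -> B/I, and its restriction B^k -> (B/I)^k. *)
Definition rho : {lrmorphism B -> factor} := hpi.

Lemma rho_homog k b : b \in homog B k -> rho b \in homog factor k.
Proof. exact: hpi_homog. Qed.

Definition rho_part k (b : hpart B k) : hpart factor k :=
  Sub (rho (\val b)) (rho_homog (valP b)).

Lemma rho_part_linear k : linear (@rho_part k).
Proof. by move=> a x y; apply: val_inj; exact: (linearP rho). Qed.

End FactorAlgebra.

Record hform (K : fieldType) (n : nat) (B : gcAlg K) := HForm {
  hform_fun :> {scalar B};
  hform_neq0 : exists b, hform_fun b != 0;
  hform_homog : forall m b, m != n -> b \in homog B m -> hform_fun b = 0
}.

Section HForm.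
Variables (K : fieldType) (n : nat) (B : gcAlg K) (l : hform n B).

Lemma hform_comp b : l b = l (hcomps b n).
Proof.
have [N bE] := hcomps_sum b.
have nM : (n < maxn N n.+1)%N by rewrite leq_maxr.
rewrite {1}(bE _ (leq_maxl N n.+1)) raddf_sum (bigD1 (Ordinal nM)) //= big1 ?addr0 //.
by move=> i; rewrite -val_eqE /= => iN; rewrite (hform_homog l iN) ?hcomps_in.
Qed.

Lemma hcompsMr i k (x b : B) : b \in homog B k ->
  hcomps (x * b) (i + k)%N = hcomps x i * b.
Proof.
move=> bk; have [N xE] := hcomps_sum x.
have iM : (i < maxn N i.+1)%N by rewrite leq_maxr.
rewrite {1}(xE _ (leq_maxl N i.+1)) mulr_suml.
rewrite hcomps_bigsum (bigD1 (Ordinal iM)) //= big1 ?addr0.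
  by rewrite hcomps_id // homogM ?hcomps_in.
move=> j; rewrite -val_eqE /= => ji.
by rewrite (@hcomps_neq _ _ (j + k)%N) ?homogM ?hcomps_in // eqn_add2r eq_sym.
Qed.

(* The set I(L_l), through either of its two descriptions (annihP, annihP').  *)
Definition annih_pred : pred B := fun a => `[< forall b, l (a * b) = 0 >].

Lemma annihP a : reflect (forall b, l (a * b) = 0) (a \in annih_pred).
Proof. exact: asboolP. Qed.

Lemma hform_eq0l (a : B) : (forall k, (k <= n)%N ->
  forall b, b \in homog B (n - k) -> l (hcomps a k * b) = 0) ->
  forall b, l (a * b) = 0.
Proof.
move=> H b; have [N bE] := hcomps_sum b.
rewrite (bE _ (leqnn N)) mulr_sumr raddf_sum big1 // => j _.
have [M aE] := hcomps_sum a.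
rewrite (aE _ (leqnn M)) mulr_suml raddf_sum big1 // => i _.
have [ij|ij] := eqVneq (i + j)%N n; last first.
  by rewrite /= (hform_homog l ij) ?homogM ?hcomps_in.
by apply: H; rewrite -ij ?leq_addr // addKn hcomps_in.
Qed.

Lemma hform_eq0r (a : B) : (forall k, (k <= n)%N ->
  forall b, b \in homog B (n - k) -> l (b * hcomps a k) = 0) ->
  forall b, l (b * a) = 0.
Proof.
move=> H b; have [N bE] := hcomps_sum b.
rewrite (bE _ (leqnn N)) mulr_suml raddf_sum big1 // => j _.
have [M aE] := hcomps_sum a.
rewrite (aE _ (leqnn M)) mulr_sumr raddf_sum big1 // => i _.
have [ij|ij] := eqVneq (i + j)%N n; last first.
  by rewrite /= (hform_homog l ij) // addnC homogM ?hcomps_in.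
by apply: H; rewrite -ij ?leq_addr // addKn hcomps_in.
Qed.

Lemma hform_swap i j a b : a \in homog B i -> b \in homog B j ->
  (l (a * b) = 0) <-> (l (b * a) = 0).
Proof.
move=> ai bj; rewrite (homogC ai bj) -signr_odd.
case: odd; rewrite ?mulN1r ?mul1r // raddfN.
by split=> /eqP h; apply/eqP; [rewrite -oppr_eq0|rewrite oppr_eq0].
Qed.

Lemma annih_comp a k : a \in annih_pred -> (k <= n)%N ->
  forall b, b \in homog B (n - k) -> l (hcomps a k * b) = 0.
Proof.
move=> /annihP a0 kn b bk; rewrite -(hcompsMr k a bk) subnKC //.
by rewrite -hform_comp a0.
Qed.

Lemma hcompsMl i k (x b : B) : b \in homog B k ->
  hcomps (b * x) (i + k)%N = b * hcomps x i.
Proof.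
move=> bk; have [N xE] := hcomps_sum x.
have iM : (i < maxn N i.+1)%N by rewrite leq_maxr.
rewrite {1}(xE _ (leq_maxl N i.+1)) mulr_sumr.
rewrite hcomps_bigsum (bigD1 (Ordinal iM)) //= big1 ?addr0.
  by rewrite hcomps_id // addnC homogM ?hcomps_in.
move=> j; rewrite -val_eqE /= => ji.
rewrite (@hcomps_neq _ _ (k + j)%N) ?homogM ?hcomps_in //.
by rewrite addnC eqn_add2l eq_sym.
Qed.

Lemma annihP' a : reflect (forall b, l (b * a) = 0) (a \in annih_pred).
Proof.
apply: (iffP idP) => [aI | a0].
  apply: hform_eq0r => k kn b bk.
  by apply/(hform_swap (hcomps_in a k) bk); apply: annih_comp.
apply/annihP; apply: hform_eq0l => k kn b bk.
apply/(hform_swap (hcomps_in a k) bk); rewrite -(hcompsMl k a bk) subnKC //.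
by rewrite -hform_comp a0.
Qed.

Lemma annih_zmod : zmod_closed annih_pred.
Proof.
split=> [|x y /annihP x0 /annihP y0]; apply/annihP => b.
  by rewrite mul0r raddf0.
by rewrite mulrBl raddfB /= x0 y0 subr0.
Qed.

Lemma annih_proper : 1 \notin annih_pred.
Proof.
apply/negP => /annihP l0; have [b] := hform_neq0 l.
by rewrite -[b]mul1r l0 eqxx.
Qed.

Lemma annih_Ml a u : u \in annih_pred -> a * u \in annih_pred.
Proof. by move=> /annihP' u0; apply/annihP' => b; rewrite mulrA u0. Qed.

Lemma annih_Mr a u : u \in annih_pred -> u * a \in annih_pred.
Proof. by move=> /annihP u0; apply/annihP => b; rewrite -mulrA u0. Qed.

Lemma annih_homog u : u \in annih_pred -> forall k, hcomps u k \in annih_pred.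
Proof.
move=> uI k; apply/annihP; apply: hform_eq0l => i le_in b bi.
have [->|ik] := eqVneq i k.
  rewrite hcomps_id ?hcomps_in //; have [kn|kn] := leqP k n; last first.
    apply: (@hform_homog _ _ _ l (k + (n - i))%N).
      by rewrite gtn_eqF // ltn_addr.
    by rewrite homogM ?hcomps_in.
  have [e|ne] := eqVneq (k + (n - i))%N n.
    by apply: annih_comp => //; rewrite -[X in (X - k)%N]e addKn.
  by apply: (hform_homog l ne); rewrite homogM ?hcomps_in.
by rewrite (hcomps_neq (hcomps_in u k) ik) mul0r raddf0.
Qed.

Definition annih : hideal B :=
  HIdeal annih_zmod annih_proper annih_Ml annih_Mr annih_homog.

(* The function l_* on B/I(L_l). *)
Definition induced_fun (x : factor annih) : K := l (hrepr x).

Lemma induced_pi b : induced_fun (rho annih b) = l b.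
Proof.
have : hpi annih (hrepr (hpi annih b)) = hpi annih b by rewrite hreprK.
move=> /hpi_eq /annihP/(_ 1); rewrite mulr1 raddfB => /eqP.
by rewrite subr_eq0 => /eqP.
Qed.

Lemma induced_linear : scalar induced_fun.
Proof.
move=> a; elim/hquot_ind=> x; elim/hquot_ind=> y.
by have := linearP (rho annih) a x y => /= <-; rewrite !induced_pi linearP.
Qed.

HB.instance Definition _ :=
  GRing.isLinear.Build K (factor annih) K *%R induced_fun induced_linear.

Lemma induced_neq0 : exists x, induced_fun x != 0.
Proof. by have [b lb] := hform_neq0 l; exists (rho annih b); rewrite induced_pi. Qed.

Lemma induced_homog m x : m != n -> x \in homog (factor annih) m ->
  induced_fun x = 0.
Proof.
move=> mn /hquot_homogP[b bm <-].
by rewrite induced_pi (hform_homog l mn bm).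
Qed.

Definition induced : hform n (factor annih) :=
  @HForm K n (factor annih) induced_fun induced_neq0 induced_homog.

Lemma induced_unique (g : hform n (factor annih)) :
  (forall b, g (rho annih b) = l b) -> g =1 induced.
Proof.
move=> gl; elim/hquot_ind=> b; rewrite (gl b).
exact: esym (induced_pi b).
Qed.

End HForm.

Definition frob (K : fieldType) (n : nat) (A : gcAlg K) (l : hform n A)
  (a b : A) : K := l (a * b).

Definition nondegenerate_form (K : fieldType) (V : lmodType K) (F : V -> V -> K) :=
  (forall a, (forall b, F a b = 0) -> a = 0) /\
  (forall b, (forall a, F a b = 0) -> b = 0).

(* The function phi o rho on B^n, extended by 0 to B^i for i != n. *)
Section PullForm.
Variables (K : fieldType) (n : nat) (B : gcAlg K) (I : hideal B).
Variable phi : {scalar hpart (factor I) n}.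
Hypothesis phi_bij : bijective phi.

Definition pull_fun (b : B) : K := phi (rho_part I (hproj n b)).

Lemma pull_linear : scalar pull_fun.
Proof. by move=> a x y; rewrite /pull_fun linearP rho_part_linear linearP. Qed.

HB.instance Definition _ := GRing.isLinear.Build K B K *%R pull_fun pull_linear.

Lemma pull_funE (b : hpart B n) : pull_fun (\val b) = phi (rho_part I b).
Proof.
congr (phi (rho_part I _)); apply: val_inj => /=.
by rewrite hcomps_id // (valP b).
Qed.

Lemma pull_neq0 : exists b, pull_fun b != 0.
Proof.
have [psi _ psiK] := phi_bij.
have /hquot_homogP[b bn bE] := valP (psi 1).
exists b; have -> : pull_fun b = phi (psi 1).
  congr (phi _); apply: val_inj => /=.
  by rewrite -[LHS]/(hpi I (hcomps b n)) hcomps_id.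
by rewrite psiK oner_neq0.
Qed.

Lemma pull_homog m b : m != n -> b \in homog B m -> pull_fun b = 0.
Proof.
move=> mn bm; rewrite /pull_fun.
suff -> : rho_part I (hproj n b) = 0 by rewrite raddf0.
by apply: val_inj; rewrite /= (hcomps_neq bm) 1?eq_sym // raddf0.
Qed.

Definition pull_form : hform n B := @HForm K n B pull_fun pull_neq0 pull_homog.

End PullForm.

(* Main.v *)
(** In each degree, non-degeneracy of the pairings of [B/I] identifies [I] with
    the annihilator of [phi \o rho], so the two ideals are equal.  Conversely,
    since [B^0] consists of scalars, an element of [B^n] killed by [l] lies in
    [I(L_l)]; hence [l] induces an isomorphism from the part of degree [n] of
    [B/I(L_l)] to [K].  The pairings are non-degenerate because an element of
    [B^k] is in [I(L_l)] as soon as [l] kills its products with [B^(n-k)]. *)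
Require Import Defs.
From mathcomp Require Import all_boot all_order all_algebra.
From mathcomp Require Import boolp.
Import GRing.Theory.
Local Open Scope ring_scope.

(** All fields but the predicate are propositions, so proof irrelevance applies. Leibniz equality
    lets one ideal replace the other inside [factor]. *)
Lemma hideal_eq {K : fieldType} {B : gcAlg K} {I J : hideal B} :
  hid_pred I =1 hid_pred J -> I = J.
Proof.
case: I => p p1 p2 p3 p4 p5; case: J => q q1 q2 q3 q4 q5 /= /funext epq.
by subst q; congr HIdeal; apply: Prop_irrelevance.
Qed.

Lemma graded_iso_refl {K : fieldType} (A : gcAlg K) : graded_iso A A.
Proof.
exists (idfun : {lrmorphism A -> A}); split=> //.
by exists idfun.
Qed.

Lemma rho_eq0 {K : fieldType} {B : gcAlg K} {I : hideal B} b :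
  rho I b = 0 <-> b \in hid_pred I.
Proof.
rewrite -[X in _ = X](raddf0 (hpi I)); split=> [/hpi_eq|bI]; first by rewrite subr0.
by apply/hpi_eq; rewrite subr0.
Qed.

(** The unit is a nonzero vector of a line, so its coordinate [c] on the basis vector is
    invertible. *)
Lemma degree0_scalar {K : fieldType} {B : gcAlg K} :
  1 \in homog B 0 -> has_dim (hpart B 0) 1 ->
  forall b, b \in homog B 0 -> exists s : K, b = s *: 1.
Proof.
move=> u0 [e eP].
have scal x : x \in homog B 0 -> exists c : K, x = c *: \val (e 0).
  move=> x0; have [c [+ _]] := eP (Sub x x0).
  by rewrite big_ord1 => /(congr1 val) /= xE; exists (c 0 0).
have [c cE] := scal _ u0; move=> b /scal[d ->].
have c0 : c != 0.
  by apply: contra_eq_neq cE => ->; rewrite scale0r oner_neq0.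
by exists (d / c); rewrite cE scalerA mulfVK.
Qed.

Lemma annih_pull_form {K : fieldType} {B : gcAlg K} {n} {I : hideal B}
    {phi : {scalar hpart (factor I) n}} (phi_bij : bijective phi) :
  self_dual n (factor I) -> I = annih (pull_form phi_bij).
Proof.
move=> [_ A0 _ nd]; apply: hideal_eq => a; apply/idP/idP => [aI|aJ].
  apply/annihP => b; rewrite /= /pull_fun.
  suff -> : rho_part I (hproj n (a * b)) = 0 by rewrite raddf0.
  by apply: val_inj; apply/rho_eq0; apply: hid_homog; apply: hid_Mr.
(* It suffices to treat each homogeneous component of [a]: degrees above [n] vanish in the quotient,
   the others are tested by the pairing. *)
have [N aE] := hcomps_sum a; rewrite (aE _ (leqnn N)).
apply: rpred_sum => i _; apply/rho_eq0.
have [ni|le_in] := ltnP n i.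
  exact: (congr1 val (A0 _ ni (rho_part I (hproj i a)))).
have [+ _] := nd _ le_in => /(_ (rho_part I (hproj i a))) nda.
apply: (congr1 val (nda _)) => -[_ /[dup] /hquot_homogP[b bk <-] bk'].
have := annih_comp (l := pull_form phi_bij) aJ le_in bk.
have abn : hcomps a i * b \in homog B n.
  by rewrite -(subnKC le_in) homogM ?hcomps_in.
rewrite /= -[hcomps a i * b]/(\val (Sub (hcomps a i * b) abn : hpart B n)) pull_funE.
(* Injectivity of [phi] turns the vanishing of the form into a zero product in the quotient. *)
rewrite -(raddf0 phi) => /(bij_inj phi_bij)/(congr1 val) /= <-.
by rewrite [RHS]rmorphM.
Qed.

Lemma annih_top {K : fieldType} {B : gcAlg K} {n} {l : hform n B} {x} :
  1 \in homog B 0 -> has_dim (hpart B 0) 1 ->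
  x \in homog B n -> l x = 0 -> x \in annih_pred l.
Proof.
move=> u0 d0 xn lx; apply/annihP; apply: hform_eq0l => k kn b.
have [->|nk] := eqVneq k n; last by rewrite (hcomps_neq xn) // mul0r raddf0.
rewrite subnn => /(degree0_scalar u0 d0)[s ->].
by rewrite hcomps_id // -scalerAr mulr1 linearZ /= lx mulr0.
Qed.

(** [hform_eq0l] tests only components of degree at most [n], and those of [x] are all zero. *)
Lemma annih_above {K : fieldType} {B : gcAlg K} {n} {l : hform n B} {k x} :
  (n < k)%N -> x \in homog B k -> x \in annih_pred l.
Proof.
move=> nk xk; apply/annihP; apply: hform_eq0l => i le_in b _.
by rewrite (hcomps_neq xk) ?mul0r ?raddf0 // ltn_eqF // (leq_ltn_trans le_in).
Qed.

Lemma factor_annih_top_dim {K : fieldType} {B : gcAlg K} {n} (l : hform n B) :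
  1 \in homog B 0 -> has_dim (hpart B 0) 1 ->
  has_dim (hpart (factor (annih l)) n) 1.
Proof.
move=> u0 d0; have [b] := hform_neq0 l; rewrite hform_comp.
set e := hcomps b n => le0; have en : e \in homog B n := hcomps_in b n.
exists (fun=> rho_part (annih l) (hproj n b)) => -[_ /[dup] /hquot_homogP[c cn <-] cn'].
(* This coefficient makes [l] vanish on [c - (l c / l e) *: e], so [annih_top] applies; evaluating
   [induced l] shows that it is forced. *)
exists (const_mx (l c / l e)); split=> [|d].
  apply: val_inj; rewrite big_ord1 mxE /= -[hpi _ _ in RHS]/(rho (annih l) e).
  rewrite -[hpi _ _]/(rho (annih l) c) -linearZ; apply/hpi_eq.
  apply: annih_top => //; first by rewrite rpredB ?rpredZ.
  by rewrite raddfB /= linearZ /= mulfVK // subrr.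
rewrite big_ord1 => /(congr1 (induced l \o val)) /=.
rewrite -[hpi _ c]/(rho (annih l) c) -/e.
rewrite -[RHS]/(induced l (d 0 0 *: rho (annih l) e)) linearZ /= !induced_pi => lcE.
by apply/rowP => j; rewrite !mxE ord1 lcE mulfK.
Qed.

Lemma factor_annih_pairing {K : fieldType} {B : gcAlg K} {n} {l : hform n B} {k}
    (a : hpart (factor (annih l)) k) : (k <= n)%N ->
  (forall b : hpart (factor (annih l)) (n - k), \val a * \val b = 0) -> a = 0.
Proof.
case: a => _ /[dup] /hquot_homogP[a ak <-] ak' kn ab0; apply: val_inj.
apply/rho_eq0/annihP; apply: hform_eq0l => i le_in b bi.
have [ik|ik] := eqVneq i k; last by rewrite (hcomps_neq ak) // mul0r raddf0.
rewrite ik in bi *; rewrite hcomps_id // -induced_pi rmorphM.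
by have /= -> := ab0 (rho_part _ (Sub b bi : hpart B _)); rewrite (raddf0 (induced l)).
Qed.

Lemma factor_annih_self_dual {K : fieldType} {B : gcAlg K} {n} (l : hform n B) :
  1 \in homog B 0 -> has_dim (hpart B 0) 1 -> self_dual n (factor (annih l)).
Proof.
move=> u0 d0; split.
- exact: (rho_homog (annih l) u0).
- move=> k nk [_ /[dup] /hquot_homogP[x xk <-] xk']; apply: val_inj.
  by apply/rho_eq0; apply: (annih_above nk xk).
- exact: factor_annih_top_dim.
- move=> k kn; split=> [a|b ab0]; first exact: factor_annih_pairing.
  (* The right kernel is a left kernel in degree [n - k], after exchanging the factors up to
     sign. *)
  apply: factor_annih_pairing; first exact: leq_subr.
  rewrite (subKn kn) => a.
  by rewrite (homogC (valP b) (valP a)) ab0 mulr0.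
Qed.

(** The left and right kernels pull back to the two descriptions of the annihilator, [annihP] and
    [annihP']. *)
Lemma frob_induced_nondegenerate {K : fieldType} {B : gcAlg K} {n} (l : hform n B) :
  nondegenerate_form (frob (induced l)).
Proof.
split; elim/hquot_ind => x x0; apply/rho_eq0; [apply/annihP | apply/annihP'].
- by move=> b; rewrite -induced_pi rmorphM; apply: x0.
- by move=> b; rewrite -induced_pi rmorphM; apply: x0.
Qed.

Theorem theorem7p16 (K : fieldType) (B : gcAlg K)
    (unit_deg0 : 1 \in homog B 0) (dimB0 : has_dim (hpart B 0) 1) :
  (forall (n : nat) (I : hideal B), self_dual n (factor I) ->
     forall (phi : {scalar hpart (factor I) n}) (phi_bij : bijective phi),
       graded_iso (factor I) (factor (annih (pull_form phi_bij))))
  /\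
  (forall (n : nat) (l : hform n B),
     self_dual n (factor (annih l)) /\ nondegenerate_form (frob (induced l))).
Proof.
split=> [n I sdI phi phi_bij | n l].
  (* Since the ideals are equal, the identity serves as isomorphism. *)
  by rewrite -annih_pull_form //; apply: graded_iso_refl.
split; first exact: factor_annih_self_dual.
exact: frob_induced_nondegenerate.
Qed.
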